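(* Let $\mathfrak{B}$ be a tightly $\sigma$-filtered Boolean algebra and let $\mathcal{H}$ be a family of countable subsets of $\mathfrak{B}$ with $|\mathcal{H}|=\omega_2$. Then there exist $\mathcal{H}'\subseteq\mathcal{H}$ with $|\mathcal{H}'|=\omega_2$ and a countable subalgebra $R\subseteq\mathfrak{B}$ such that for every $n$, every Boolean polynomial $P(x_1,\ldots,x_n)$, every pairwise different $H_1,\ldots,H_n\in\mathcal{H}'$ and every $a_i\in H_i$: if $P(a_1,\ldots,a_n)=0$, then there exist $r_i^-,r_i^+\in R$ with $r_i^-\le a_i\le r_i^+$ ($i=1,\ldots,n$) and $P(r_1^{\varepsilon_1},\ldots,r_n^{\varepsilon_n})=0$ for every choice of signs $\varepsilon_i\in\{+,-\}$.
   Context: For a subset $X$ of a Boolean algebra, $\langle X\rangle$ is the subalgebra generated by $X$. Two subalgebras $A,S$ of a Boolean algebra commute if whenever $a\in A$, $s\in S$ and $a\wedge s=0$, there exist $b_1,b_2\in A\cap S$ with $a\le b_1$, $s\le b_2$, $b_1\wedge b_2=0$. A square of inclusions $R\subseteq A\subseteq B$, $R\subseteq S\subseteq B$ is a push-out diagram if $\langle A\cup S\rangle=B$, $A\cap S=R$, and $A$ and $S$ commute. A Boolean algebra $\mathfrak{B}$ is tightly $\sigma$-filtered if there is an increasing chain of subalgebras $(B_\alpha)_{\alpha<\xi}$ indexed by an ordinal $\xi$ with: $B_0=\{0,1\}$; $\mathfrak{B}=\bigcup_{\alpha<\xi}B_\alpha$; $B_\alpha=\bigcup_{\beta<\alpha}B_\beta$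 for limit $\alpha$; and for every $\alpha<\xi$ there are countable subalgebras $R_\alpha,S_\alpha\subseteq\mathfrak{B}$ such that the inclusions $R_\alpha\subseteq B_\alpha\subseteq B_{\alpha+1}$, $R_\alpha\subseteq S_\alpha\subseteq B_{\alpha+1}$ form a push-out diagram. *)

(* Defs.v *)
(* Boolean algebras are mathcomp's ctbDistrLatticeType
   (complemented distributive lattices with top and bottom);
   sets are MathComp-Analysis classical sets. *)
From mathcomp Require Import all_boot all_order.
From mathcomp Require Import boolp classical_sets cardinality.

Set Implicit Arguments.
Unset Strict Implicit.
Unset Printing Implicit Defensive.

Local Open Scope classical_set_scope.

Section BA.
Context {d : Order.disp_t} {T : ctbDistrLatticeType d}.

Notation meet := (@Order.meet d T).
Notation join := (@Order.join d T).
Notation bot := (@Order.bottom d T).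
Notation top := (@Order.top d T).
Notation cmp := (@Order.compl d T).
Notation le := (@Order.le d T).

Definition subalgebra (A : set T) : Prop :=
  [/\ A bot, A top,
      (forall x y, A x -> A y -> A (meet x y)),
      (forall x y, A x -> A y -> A (join x y)) &
      (forall x, A x -> A (cmp x))].

Definition gen (X : set T) : set T :=
  [set x | forall C, subalgebra C -> X `<=` C -> C x].

Definition commute_sub (A S : set T) : Prop :=
  forall a s, A a -> S s -> meet a s = bot ->
    exists b1 b2, [/\ (A `&` S) b1, (A `&` S) b2, le a b1, le s b2 &
                      meet b1 b2 = bot].

Definition pushout (R A S B : set T) : Prop :=
  [/\ R `<=` A, A `<=` B, R `<=` S & S `<=` B] /\
  [/\ gen (A `|` S) = B, A `&` S = R & commute_sub A S].

(* Tightly sigma-filtered: the ordinal xi is represented by a type I with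
   a strict well-order lt. *)
Definition tightly_sigma_filtered : Prop :=
  exists (I : Type) (lt : I -> I -> Prop) (B : I -> set T),
    (forall i, ~ lt i i) /\
    (forall i j k, lt i j -> lt j k -> lt i k) /\
    (forall i j, i = j \/ lt i j \/ lt j i) /\
    (forall X : set I, X !=set0 ->
        exists2 m, X m & forall j, X j -> ~ lt j m) /\
    (forall i, subalgebra (B i)) /\
    (forall i j, lt i j -> B i `<=` B j) /\
    (forall i, (forall j, ~ lt j i) -> B i = [set x | x = bot \/ x = top]) /\
    (forall x : T, exists i, B i x) /\
    (forall i, (exists j, lt j i) ->
        (forall j, lt j i -> exists k, lt j k /\ lt k i) ->
        B i = [set x | exists2 j, lt j i & B j x]) /\
    (forall i i', lt i i' -> (forall k, ~ (lt i k /\ lt k i')) ->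
        exists R S : set T,
          [/\ countable R, countable S, subalgebra R, subalgebra S &
              pushout R (B i) S (B i')]).

End BA.

Definition wo_on {U : Type} (X : set U) (r : U -> U -> Prop) : Prop :=
  [/\ (forall x, X x -> ~ r x x),
      (forall x y z, X x -> X y -> X z -> r x y -> r y z -> r x z),
      (forall x y, X x -> X y -> x = y \/ r x y \/ r y x) &
      (forall Y, Y `<=` X -> Y !=set0 ->
         exists2 m, Y m & forall y, Y y -> ~ r y m)].

(* |X| <= aleph_1 : X carries a well-order of type <= omega_1, i.e. all of
   whose proper initial segments are countable. *)
Definition card_le_aleph1 {U : Type} (X : set U) : Prop :=
  exists r, wo_on X r /\
    forall x, X x -> countable [set y | X y /\ r y x].

(* |X| = aleph_2 : X carries a well-order of order type exactly omega_2,
   i.e. all proper initial segments have size <= aleph_1 while X itself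
   does not. *)
Definition card_eq_aleph2 {U : Type} (X : set U) : Prop :=
  (exists r, wo_on X r /\
     forall x, X x -> card_le_aleph1 [set y | X y /\ r y x]) /\
  ~ card_le_aleph1 X.

Inductive bpoly (n : nat) : Type :=
  | BVar of 'I_n
  | BBot
  | BTop
  | BMeet of bpoly n & bpoly n
  | BJoin of bpoly n & bpoly n
  | BCompl of bpoly n.

Fixpoint beval {d : Order.disp_t} {T : ctbDistrLatticeType d} {n : nat}
    (P : bpoly n) (v : 'I_n -> T) : T :=
  match P with
  | BVar i => v i
  | BBot => Order.bottom
  | BTop => Order.top
  | BMeet p q => Order.meet (beval p v) (beval q v)
  | BJoin p q => Order.join (beval p v) (beval q v)
  | BCompl p => Order.compl (beval p v)
  end.

(* Main.v *)
Require Import Defs.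
From mathcomp Require Import all_boot all_order.
From mathcomp Require Import boolp classical_sets cardinality.

(* Write B_{i+1} = <B_i, S_i> with B_i and S_i separated over the countable
   R_i. For a set G of stages let E(G) be generated by the S_i with i in G, and
   call G closed when R_i lies in E(G cut below i) for each i in G. Closed sets
   are stable under unions, every countable subset of the algebra lies in E(G)
   for a countable closed G, and transfinite induction shows that E(G) and E(G')
   are separated over E(G /\ G') when G and G' are closed.

   Attach to each H in the family a countable closed G_H. Among aleph_2
   countable sets there are aleph_2 whose pairwise intersections lie in one
   countable set; enlarge it to a countable closed G_0 and put R = E(G_0).
   Separating the E(G_H) from each other over R one at a time turns a vanishing
   meet of elements of different H's into a vanishing meet of upper bounds in R.
   Applying this to the minterms of P gives the bounds. *)

Set Implicit Arguments.
Unset Strict Implicit.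
Unset Printing Implicit Defensive.

Import Order.LTheory Order.CTheory.

Local Open Scope classical_set_scope.

(** * Sets of cardinality at most aleph_1 *)

Lemma countable_subset {U : Type} (A B : set U) :
  A `<=` B -> countable B -> countable A.
Proof. by move=> AB; apply: sub_countable; exact: subset_card_le. Qed.

Lemma countable_setU {U : Type} (A B : set U) :
  countable A -> countable B -> countable (A `|` B).
Proof.
by move=> cA cB; rewrite -bigcup2E; apply: bigcup_countable => // -[|[|]].
Qed.

Lemma wo_on_sub {U : Type} (A B : set U) (r : U -> U -> Prop) :
  A `<=` B -> wo_on B r -> wo_on A r.
Proof.
move=> AB [irr tr tot min]; split.
- by move=> x /AB; exact: irr.
- by move=> x y z /AB Bx /AB By /AB; exact: tr.
- by move=> x y /AB Bx /AB; exact: tot.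
- by move=> Y YA; apply: min; exact: subset_trans AB.
Qed.

Lemma card_le_aleph1_sub {U : Type} (A B : set U) :
  A `<=` B -> card_le_aleph1 B -> card_le_aleph1 A.
Proof.
move=> AB [r [wor cr]]; exists r; split; first exact: wo_on_sub wor.
move=> x /AB /cr; apply: countable_subset => y [/AB]; by split.
Qed.

(* Elements are ordered by the first index of a member of the cover containing
   them, then by an enumeration of that member. *)
Lemma card_le_aleph1_cover {U V : Type} (D : set V) (C : V -> set U)
    (X : set U) :
  card_le_aleph1 D -> (forall v, D v -> countable (C v)) ->
  X `<=` \bigcup_(v in D) C v -> card_le_aleph1 X.
Proof.
move=> [r [[irr tr tot min] segD]] cC XC.
have [v0|noV] := pselect (exists v, D v); last first.
  exists (fun _ _ => False); split; last first.
    by move=> x _; apply: countable_subset (countable0 _) => y [].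
  split=> [x _ []|//|x y /XC[v Dv]|Y YX [y /YX/XC[v Dv]]].
    by case: noV; exists v.
  by case: noV; exists v.
(* The premise [X x] sits under the existential so that [choice] yields a total function; off [X]
   any value will do. *)
have rank_ex x : exists v, X x ->
    [/\ D v, C v x & forall u, D u -> C u x -> ~ r u v].
  have [Xx|nXx] := pselect (X x); last by case: v0 => v; exists v.
  have [||v [Dv Cv] vmin] := min [set v | D v /\ C v x].
  - by move=> v [].
  - by have [v Dv Cv] := XC x Xx; exists v.
  - by exists v => _; split=> // u Du Cu; apply: vmin.
have [rk rkP] := choice rank_ex.
have enum_ex v : exists f : U -> nat, D v -> {in C v &, injective f}.
  have [Dv|nDv] := pselect (D v); last by exists (fun=> 0%N).
  by have /countable_injP[f fP] := cC v Dv; exists f.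
have [f fP] := choice enum_ex.
pose s x y := r (rk x) (rk y) \/ rk x = rk y /\ (f (rk x) x < f (rk y) y)%N.
exists s; split; first split.
- move=> x Xx; have [Dx _ _] := rkP x Xx.
  by move=> [/(irr _ Dx)//|[_]]; rewrite ltnn.
- move=> x y z Xx Xy Xz.
  have [Dx _ _] := rkP x Xx; have [Dy _ _] := rkP y Xy.
  have [Dz _ _] := rkP z Xz.
  move=> [xy|[exy lxy]] [yz|[eyz lyz]].
  + by left; exact: tr yz.
  + by left; rewrite -eyz.
  + by left; rewrite exy.
  + by right; split; [rewrite exy|exact: ltn_trans lyz].
- move=> x y Xx Xy.
  have [Dx Cx _] := rkP x Xx; have [Dy Cy _] := rkP y Xy.
  have [exy|[xy|yx]] := tot _ _ Dx Dy; [|by right; left; left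
    |by right; right; left].
  have [lxy|lyx|fxy] := ltngtP (f (rk x) x) (f (rk y) y).
  + by right; left; right.
  + by right; right; right.
  + left; apply: (fP (rk x) Dx); rewrite ?inE //; first by rewrite exy.
    by rewrite fxy exy.
- move=> Y YX [y0 Yy0].
  have [||v [y1 Yy1 y1v] vmin] := min (rk @` Y).
  - by move=> _ [y Yy <-]; have [] := rkP y (YX y Yy).
  - by exists (rk y0), y0.
  have exn : exists n, `[< exists y, [/\ Y y, rk y = v & f v y = n] >].
    by exists (f v y1); apply/asboolP; exists y1.
  case: (ex_minnP exn) => n /asboolP[m [Ym mv fm]] nmin.
  exists m => // y Yy [ym|[eym lym]].
    by apply: (vmin (rk y)); [exists y|rewrite -mv].
  have /nmin : `[< exists z, [/\ Y z, rk z = v & f v z = f v y] >].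
    by apply/asboolP; exists y; rewrite eym.
  by rewrite -fm leqNgt; move: lym; rewrite eym mv => ->.
- move=> x Xx; have [Dx _ _] := rkP x Xx.
  (* Predecessors of [x] lie in cover members of rank at most [rk x], and there are only countably
     many such ranks. *)
  apply: (@countable_subset _ _
    (\bigcup_(v in [set u | D u /\ r u (rk x)] `|` [set rk x]) C v)).
    move=> y [Xy]; have [Dy Cy _] := rkP y Xy.
    by move=> [yx|[exy _]]; exists (rk y) => //; [left|right].
  apply: bigcup_countable => [|v [[]|->]]; [|by move=> /cC|exact: cC].
  by apply: countable_setU => //; exact: segD.
Qed.

Lemma countable_card_le_aleph1 {U : Type} (A : set U) :
  countable A -> card_le_aleph1 A.
Proof.
move=> cA; have one : card_le_aleph1 [set: unit].
  exists (fun _ _ => False); split; last by move=> x _; exact: countableP.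
  by split=> [x _ []|//|[] [] _ _|Y _ [y Yy]]; [left|exists y => // z _ []].
by apply: (card_le_aleph1_cover one (fun _ _ => cA)) => x Ax; exists tt.
Qed.

(** * Well-orders of type omega_1 *)

Definition omega1_type {U : Type} (W : set U) (r : U -> U -> Prop) : Prop :=
  [/\ wo_on W r, (forall w, W w -> countable [set v | W v /\ r v w]) &
      ~ countable W].

(** Take the segment below the least point with uncountably many predecessors. Such a point exists,
    since otherwise [r] itself would witness [card_le_aleph1 X]. *)
Lemma omega1_type_exists {U : Type} (X : set U) (r : U -> U -> Prop) :
  wo_on X r -> ~ card_le_aleph1 X -> exists W : set U, omega1_type W r.
Proof.
move=> wor nX; have [irr tr tot min] := wor.
have [x0 [Xx0 nx0]] : exists x, X x /\ ~ countable [set y | X y /\ r y x].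
  apply: contrapT => H; apply: nX; exists r; split=> // x Xx.
  by apply: contrapT => ncx; apply: H; exists x.
have [||x [Xx ncx] xmin] :=
    min [set x | X x /\ ~ countable [set y | X y /\ r y x]].
- by move=> x [].
- by exists x0.
exists [set y | X y /\ r y x]; split=> //.
  by apply: wo_on_sub wor => y [].
move=> w [Xw rwx]; apply: (@countable_subset _ _ [set y | X y /\ r y w]).
  by move=> y [[]].
by apply: contrapT => ncw; apply: (xmin w).
Qed.

Lemma omega1_bounded {U : Type} (W A : set U) (r : U -> U -> Prop) :
  omega1_type W r -> countable A -> A `<=` W ->
  exists2 w, W w & forall a, A a -> r a w.
Proof.
move=> [[irr tr tot _] seg nW] cA AW; apply: contrapT => H; apply: nW.
apply: (@countable_subset _ _
  (\bigcup_(a in A) ([set v | W v /\ r v a] `|` [set a]))); last first.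
  apply: bigcup_countable => // a /AW Wa.
  by apply: countable_setU => //; exact: seg.
move=> w Ww; apply: contrapT => H'; apply: H; exists w => // a Aa.
have [wa|[wa|//]] := tot _ _ Ww (AW _ Aa); case: H'; exists a => //.
  by right.
by left.
Qed.

(** Requiring both points to lie in [W] makes the relation well-founded on all of [U]: points off
    [W] have no predecessors. *)
Definition strictly_below {U : Type} (W : set U) (r : U -> U -> Prop) (w : U) :
  set U := [set v | [/\ W v, W w & r v w]].

Lemma well_founded_of_minima {U : Type} (r : U -> U -> Prop) :
  (forall Y : set U, Y !=set0 -> exists2 m, Y m & forall y, Y y -> ~ r y m) ->
  well_founded r.
Proof.
move=> min x; apply: contrapT => nx.
have [|m nm mmin] := min [set x | ~ Acc r x]; first by exists x.
apply: nm; constructor=> y rym; apply: contrapT => ny; exact: (mmin y).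
Qed.

Lemma wo_on_well_founded {U : Type} (W : set U) (r : U -> U -> Prop) :
  wo_on W r -> well_founded (fun v w => strictly_below W r w v).
Proof.
move=> [irr tr tot min]; apply: well_founded_of_minima => Y [y Yy].
have [[w [Yw Ww]]|noW] := pselect (exists w, Y w /\ W w); last first.
  by exists y => // z Yz [Wz _ _]; apply: noW; exists z.
have [||m [Ym Wm] mmin] := min (Y `&` W); first by move=> z [].
  by exists w.
by exists m => // z Yz [Wz _ rzm]; apply: (mmin z).
Qed.

(** Well-founded recursion in which step [w] sees only the union of the earlier values; both omega_1
    constructions below are instances. *)
Lemma transfinite_iteration {U V : Type} (s : U -> U -> Prop)
    (G : set V -> set V) :
  well_founded s ->
  exists M : U -> set V,
    forall w, M w = G (\bigcup_(v in [set v | s v w]) M v).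
Proof.
move=> wf.
pose F w (rec : forall v, s v w -> set V) : set V :=
  G [set x | exists v (h : s v w), rec v h x].
exists (Fix wf (fun=> set V) F) => w; rewrite Fix_eq; last first.
  by move=> x f g fg; congr G; apply/seteqP; split=> z [v [h fz]];
     exists v, h; [rewrite -fg|rewrite fg].
congr G; apply/seteqP; split=> z.
  by move=> [v [h Mz]]; exists v.
by move=> [v h Mz]; exists v, h.
Qed.

(* [C w] consists of the union [K w] of the earlier members and the least
   element of [X] outside [K w]. *)
Lemma omega1_cover {U V : Type} (W : set U) (r : U -> U -> Prop) (X : set V) :
  omega1_type W r -> card_le_aleph1 X ->
  exists C : U -> set V,
    (forall w, W w -> countable (C w)) /\ X `<=` \bigcup_(w in W) C w.
Proof.
move=> omW [s [[irr tr tot min] segX]]; have [woW segW ncW] := omW.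
have wf := wo_on_well_founded woW.
have [C CE] := transfinite_iteration
  (fun K => [set x | X x /\ forall y, X y -> s y x -> K y]) wf.
pose K w := \bigcup_(v in strictly_below W r w) C v.
exists C; split.
  move=> w; elim: (wf w) => {}w _ IH Ww.
  have cK : countable (K w).
    apply: bigcup_countable => [|v vw]; last by apply: IH => //; case: vw.
    by apply: countable_subset (segW w Ww) => v [].
  (* Of two distinct points of [C w] outside [K w], the larger would force the smaller into [K w];
     so at most one point is new. *)
  have [[x [Cx nKx]]|CK] := pselect (exists x, C w x /\ ~ K w x); last first.
    apply: countable_subset cK => x Cx.
    by apply: contrapT => nKx; apply: CK; exists x.
  apply: (@countable_subset _ _ (K w `|` [set x])); last exact: countable_setU.
  move=> y Cy; have [Ky|nKy] := pselect (K w y); [by left|right => /=].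
  move: Cx Cy; rewrite !CE => -[Xx xmin] [Xy ymin].
  have [//|[yx|xy]] := tot _ _ Xy Xx.
    by case: nKy; exact: xmin.
  by case: nKx; exact: ymin.
(* A least uncovered [x] has countably many predecessors, all covered at indices below some [w];
   then [C w] contains [x]. *)
apply: contrapT => nXC.
have [||x [Xx nCx] xmin] := min [set x | X x /\ ~ (\bigcup_(w in W) C w) x].
- by move=> x [].
- apply: contrapT => H; apply: nXC => x Xx; apply: contrapT => nCx.
  by apply: H; exists x.
have idx_ex y : exists w, X y -> s y x -> W w /\ C w y.
  have [[Xy syx]|nyx] := pselect (X y /\ s y x).
    apply: contrapT => H; apply: (xmin y) => //; split=> // -[w Ww Cw].
    by apply: H; exists w.
  have /eqP/set0P[w _] : W <> set0 by move=> W0; apply: ncW; rewrite W0.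
  by exists w => Xy syx; case: nyx.
have [i iP] := choice idx_ex.
have [||w Ww wP] := @omega1_bounded _ W (i @` [set y | X y /\ s y x]) r omW.
- apply: sub_countable (segX x Xx); exact: card_image_le.
- by move=> _ [y [Xy syx] <-]; case: (iP y Xy syx).
apply: nCx; exists w => //; rewrite CE; split=> // y Xy syx.
have [Wi Ci] := iP y Xy syx; exists (i y) => //; split=> //.
by apply: wP; exists y.
Qed.

(** Cover [D] and each [X v] by countable sets indexed along [W]. A point is located by a pair of
    indices; the pairs with both entries at most [w] are countably many, so the union is covered
    along [W] by countable sets. *)
Lemma card_le_aleph1_bigcup {U V V' : Type} (W : set U) (r : U -> U -> Prop)
    (D : set V) (X : V -> set V') :
  omega1_type W r -> card_le_aleph1 D ->
  (forall v, D v -> card_le_aleph1 (X v)) ->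
  card_le_aleph1 (\bigcup_(v in D) X v).
Proof.
move=> omW leD leX; have [woW segW ncW] := omW.
have [C [cC DC]] := omega1_cover omW leD.
have cov_ex v : exists K : U -> set V', D v ->
    (forall w, W w -> countable (K w)) /\ X v `<=` \bigcup_(w in W) K w.
  have [Dv|nDv] := pselect (D v); last by exists (fun=> set0).
  by have [K KP] := omega1_cover omW (leX v Dv); exists K.
have [K KP] := choice cov_ex.
have leW : card_le_aleph1 W by exists r.
pose upto w := [set v | W v /\ r v w] `|` [set w].
have cupto w : W w -> countable (upto w).
  by move=> Ww; apply: countable_setU => //; exact: segW.
have Wupto w u : W w -> upto w u -> W u by move=> Ww [[]|->].
apply: (@card_le_aleph1_cover _ _ W (fun w => \bigcup_(u in upto w)
  \bigcup_(v in C u `&` D) \bigcup_(u' in upto w) K v u') _ leW).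
  move=> w Ww; apply: bigcup_countable => [|u uw]; first exact: cupto.
  apply: bigcup_countable => [|v [_ Dv]].
    by apply: countable_subset (cC u (Wupto _ _ Ww uw)) => v [].
  apply: bigcup_countable => [|u' uw']; first exact: cupto.
  by have [cK _] := KP v Dv; apply: cK; exact: Wupto uw'.
move=> x [v Dv Xx]; have [u Wu Cu] := DC v Dv.
have [_ /(_ x Xx)[u' Wu' Ku']] := KP v Dv.
have [_ _ tot _] := woW.
have [euu|[uu'|u'u]] := tot u u' Wu Wu'.
- exists u' => //; exists u; first by right.
  by exists v => //; exists u' => //; right.
- exists u' => //; exists u; first by left.
  by exists v => //; exists u' => //; right.
- exists u => //; exists u; first by right.
  by exists v => //; exists u' => //; left.
Qed.

(** * Almost disjoint subfamilies *)

(** Zorn's lemma: a pairwise condition passes to unions of chains, and an [x] violating the last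
    clause could be added to [Y]. *)
Lemma maximal_disjoint_modulo {U V : Type} (X : set U) (G : U -> set V)
    (M : set V) :
  exists Y : set U,
    [/\ Y `<=` X,
        (forall x y, Y x -> Y y -> x <> y -> G x `&` G y `<=` M) &
        (forall x, X x -> ~ Y x ->
           exists y, Y y /\ ~ (G x `&` G y `<=` M))].
Proof.
pose P := [set Y : set U | Y `<=` X /\
  forall x y, Y x -> Y y -> x <> y -> G x `&` G y `<=` M].
have [F FP Ftot|Y [[YX YM] Ymax]] := @Zorn_bigcup _ P.
  split=> [x [Y FY Yx]|x y [Y FY Yx] [Z FZ Zy]].
    by have [YX _] := FP Y FY; exact: YX.
  have [YZ|ZY] := Ftot Y Z FY FZ.
    by have [_] := FP Z FZ; apply=> //; exact: YZ.
  by have [_] := FP Y FY; apply=> //; exact: ZY.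
exists Y; split=> // x Xx nYx; apply: contrapT => H.
apply: (Ymax (Y `|` [set x])).
  split=> [|/(_ x)]; first exact: subsetUl.
  by move=> /(_ (or_intror erefl)).
have HM y : Y y -> G x `&` G y `<=` M.
  by move=> Yy; apply: contrapT => nM; apply: H; exists y.
split=> [z [/YX//|->//]|u v [Yu|->] [Yv|->] uv] //.
- exact: YM.
- by rewrite setIC; exact: HM.
- exact: HM.
Qed.

(* If every family disjoint modulo a set of size aleph_1 were small, iterating
   "adjoin a maximal such family" through omega_1 would leave an [x] whose
   countable set [G x] meets all omega_1 increments. *)
Lemma large_disjoint_modulo_aleph1 {U V : Type} (X : set U) (G : U -> set V)
    (r : U -> U -> Prop) :
  wo_on X r -> ~ card_le_aleph1 X -> (forall x, X x -> countable (G x)) ->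
  exists (M : set V) (Y : set U),
    [/\ card_le_aleph1 M, Y `<=` X, ~ card_le_aleph1 Y &
        forall x y, Y x -> Y y -> x <> y -> G x `&` G y `<=` M].
Proof.
move=> wor nX cG; apply: contrapT => H.
have [W omW] := omega1_type_exists wor nX; have [woW segW ncW] := omW.
have [F FP] := choice (maximal_disjoint_modulo X G).
have leF M : card_le_aleph1 M -> card_le_aleph1 (F M).
  move=> leM; apply: contrapT => nF; apply: H; exists M, (F M).
  by have [] := FP M.
pose N M := M `|` \bigcup_(y in F M) G y.
have leN M : card_le_aleph1 M -> card_le_aleph1 (N M).
  move=> leM; rewrite /N -bigcup2E; apply: (card_le_aleph1_bigcup omW).
    by apply: countable_card_le_aleph1; exact: countableP.
  move=> [|[|i]] _ //=; last by apply: countable_card_le_aleph1.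
  apply: (card_le_aleph1_cover (leF _ leM)) (@subset_refl _ _) => y Fy.
  by apply: cG; have [FX _ _] := FP M; exact: FX.
have wf := wo_on_well_founded woW.
have [M ME] := transfinite_iteration N wf.
pose K w := \bigcup_(v in strictly_below W r w) M v.
have leK w : W w -> card_le_aleph1 (K w).
  elim: (wf w) => {}w _ IH Ww.
  apply: (card_le_aleph1_bigcup omW).
    apply: countable_card_le_aleph1.
    by apply: countable_subset (segW w Ww) => v [].
  by move=> v vw; rewrite ME; apply: leN; apply: IH => //; case: vw.
(* The families [F (K w)] together have size at most aleph_1, so some [x] escapes them all. *)
have [x [Xx nFx]] : exists x, X x /\ ~ (\bigcup_(w in W) F (K w)) x.
  apply: contrapT => H'; apply: nX.
  apply: (@card_le_aleph1_sub _ _ (\bigcup_(w in W) F (K w))).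
    by move=> x Xx; apply: contrapT => nFx; apply: H'; exists x.
  apply: (card_le_aleph1_bigcup omW); first by exists r.
  by move=> w Ww; exact/leF/leK.
(* By maximality of [F (K w)], [G x] meets some [G y] outside [K w]; a common point enters at step
   [w]. *)
have pt w : exists i, W w -> [/\ G x i, M w i & ~ K w i].
  have [Ww|nWw] := pselect (W w); last first.
    (* A default value for [w] outside [W]: an empty [G x] would contradict maximality. *)
    have /eqP/set0P[i _] : G x <> set0; last by exists i.
    move=> Gx0; have [w' Ww'] : W !=set0.
      by apply/set0P/eqP => W0; apply: ncW; rewrite W0.
    have [_ _ Fmax] := FP (K w'); have [|y [_]] := Fmax x Xx.
      by move=> Fx; apply: nFx; exists w'.
    by apply; rewrite Gx0 => ? [].
  have [_ _ Fmax] := FP (K w); have [|y [Fy nK]] := Fmax x Xx.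
    by move=> Fx; apply: nFx; exists w.
  apply: contrapT => H'; apply: nK => i [Gxi Gyi]; apply: contrapT => nKi.
  by apply: H'; exists i => _; split=> //; rewrite ME; right; exists y.
have [p pP] := choice pt.
apply: ncW; apply: sub_countable (cG x Xx).
have pW : p @` W `<=` G x by move=> _ [w Ww <-]; case: (pP w Ww).
apply: card_le_trans (subset_card_le pW).
(* Each value is new at its index, so different indices give different values and [W] injects into
   the countable [G x]. *)
have pinj : {in W &, injective p}.
  move=> v w; rewrite !inE => Wv Ww epvw.
  have [_ Mv nKv] := pP v Wv; have [_ Mw nKw] := pP w Ww.
  have [_ _ tot _] := woW; have [//|[vw|wv]] := tot v w Wv Ww.
    by case: nKw; exists v => //; rewrite -epvw.
  by case: nKv; exists w => //; rewrite epvw.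
have := inj_card_eq pinj.
by move/card_eqPle=> [].
Qed.

(* Without CH there need be no Delta-system of size aleph_2; only a countable
   bound for the pairwise intersections is available. *)
Lemma large_disjoint_modulo_countable {U V : Type} (X : set U)
    (G : U -> set V) :
  card_eq_aleph2 X -> (forall x, X x -> countable (G x)) ->
  exists (Delta : set V) (Y : set U),
    [/\ countable Delta, Y `<=` X, card_eq_aleph2 Y &
        forall x y, Y x -> Y y -> x <> y -> G x `&` G y `<=` Delta].
Proof.
move=> [[r [wor segX]] nX] cG.
have large Y : Y `<=` X -> ~ card_le_aleph1 Y -> card_eq_aleph2 Y.
  move=> YX nY; split=> //; exists r; split; first exact: wo_on_sub wor.
  by move=> y /YX /segX; apply: card_le_aleph1_sub => z [/YX].
have [M [Y [leM YX nY YM]]] := large_disjoint_modulo_aleph1 wor nX cG.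
have [cM|ncM] := pselect (countable M).
  by exists M, Y; split=> //; exact: large.
have [s [woM segM]] := leM.
have omM : omega1_type M s by [].
(* Each countable trace of [G y] on [M] is bounded in [M], so the sets [Ym m] cover [Y]. They cannot
   all be small; for a large one, the countable segment below [m] contains the pairwise
   intersections. *)
pose Ym m := [set y | Y y /\ forall i, G y i -> M i -> s i m].
have [m [Mm nYm]] : exists m, M m /\ ~ card_le_aleph1 (Ym m).
  apply: contrapT => H; apply: nY.
  apply: (@card_le_aleph1_sub _ _ (\bigcup_(m in M) Ym m)).
    move=> y Yy; have [||m Mm mP] := @omega1_bounded _ M (G y `&` M) s omM.
    - by apply: countable_subset (cG y (YX y Yy)) => i [].
    - by move=> i [].
    - by exists m => //; split=> // i Gi Mi; exact: mP.
  apply: (card_le_aleph1_bigcup omM) => // m Mm.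
  by apply: contrapT => nYm; apply: H; exists m.
have YmX : Ym m `<=` X by move=> y [/YX].
exists [set i | M i /\ s i m], (Ym m); split=> //; [exact: segM|exact: large|].
move=> x y [Yx xm] [Yy ym] xy i [Gx Gy].
have Mi : M i by exact: (YM x y).
by split=> //; exact: xm.
Qed.

(** * Generated subalgebras and interpolation *)

Section Subalgebras.
Context {d : Order.disp_t} {T : ctbDistrLatticeType d}.
Implicit Types (A B C D R S X Y : set T).

Local Open Scope order_scope.

Lemma gen_subset X : (X `<=` gen X)%classic.
Proof. by move=> x Xx C _; apply. Qed.

Lemma gen_subalgebra X : subalgebra (gen X).
Proof.
split.
- by move=> C [].
- by move=> C [].
- by move=> x y gx gy C sC XC; case: (sC) => _ _ h _ _;
    apply: h; [apply: gx|apply: gy].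
- by move=> x y gx gy C sC XC; case: (sC) => _ _ _ h _;
    apply: h; [apply: gx|apply: gy].
- by move=> x gx C sC XC; case: (sC) => _ _ _ _; apply; exact: gx.
Qed.

Lemma gen_min X C :
  subalgebra C -> (X `<=` C)%classic -> (gen X `<=` C)%classic.
Proof. by move=> sC XC x; apply. Qed.

Lemma gen_subset_gen X Y : (X `<=` gen Y)%classic -> (gen X `<=` gen Y)%classic.
Proof. by apply: gen_min; exact: gen_subalgebra. Qed.

Lemma gen_mono X Y : (X `<=` Y)%classic -> (gen X `<=` gen Y)%classic.
Proof. by move=> XY; apply: gen_subset_gen => x /XY; exact: gen_subset. Qed.

Lemma gen_set0 : gen set0 = [set x : T | x = \bot \/ x = \top].
Proof.
apply/seteqP; split.
  apply: gen_min => //; split; [by left|by right| | |].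
  - by move=> _ _ [->|->] [->|->];
      rewrite ?meetxx ?meet0x ?meetx0; [left|left|left|right].
  - by move=> _ _ [->|->] [->|->];
      rewrite ?joinxx ?join1x ?joinx1; [left|right|right|right].
  - by move=> _ [->|->]; rewrite ?compl0 ?compl1; [right|left].
by have [g0 g1 _ _ _] := gen_subalgebra (set0 : set T) => x [->|->].
Qed.

(** Closing under the operations omega times keeps the set countable and reaches a subalgebra. *)
Lemma countable_gen X : countable X -> countable (gen X).
Proof.
move=> cX.
pose op (K : set T) (f : T -> T -> T) := (fun p => f p.1 p.2) @` (K `*` K).
pose step (K : set T) : set T :=
  (K `|` (op K Order.meet `|` (op K Order.join `|` Order.compl @` K)))%classic.
pose K n := iter n step (X `|` [set \bot; \top])%classic.
have cK n : countable (K n).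
  elim: n => [|n IH] /=.
    apply: countable_setU => //; apply: countable_setU; exact: countable1.
  have cop f : countable (op (K n) f).
    by apply: sub_countable (card_image_le _ _) _; exact: countableX.
  do !apply: countable_setU => //.
  exact: sub_countable (card_image_le _ _) _.
have KS n x : K n x -> K n.+1 x by left.
have Kle m n x : (m <= n)%N -> K m x -> K n x.
  by move=> /subnK <-; elim: (n - m)%N => // k IH /IH; exact: KS.
suff : (gen X `<=` \bigcup_(n in [set: nat]) K n)%classic.
  by move=> /countable_subset; apply; apply: bigcup_countable.
apply: gen_min; last by move=> x Xx; exists 0%N => //; left.
split.
- by exists 0%N => //; right; left.
- by exists 0%N => //; right; right.
- move=> x y [m _ Kx] [n _ Ky]; exists (maxn m n).+1 => //; right; left.
  by exists (x, y) => //; split => /=;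
    [exact: Kle (leq_maxl m n) Kx|exact: Kle (leq_maxr m n) Ky].
- move=> x y [m _ Kx] [n _ Ky]; exists (maxn m n).+1 => //; right; right; left.
  by exists (x, y) => //; split => /=;
    [exact: Kle (leq_maxl m n) Kx|exact: Kle (leq_maxr m n) Ky].
- by move=> x [m _ Kx]; exists m.+1 => //; right; right; right; exists x.
Qed.

Lemma subalgebra_bigcup {J : Type} (K : set J) (F : J -> set T) :
  (K !=set0)%classic -> (forall j, K j -> subalgebra (F j)) ->
  (forall i j, K i -> K j ->
     exists k, [/\ K k, (F i `<=` F k)%classic & (F j `<=` F k)%classic]) ->
  subalgebra (\bigcup_(j in K) F j).
Proof.
move=> [j0 Kj0] sF dF; split.
- by exists j0 => //; case: (sF j0 Kj0).
- by exists j0 => //; case: (sF j0 Kj0).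
- move=> x y [i Ki Fx] [j Kj Fy]; have [k [Kk ik jk]] := dF i j Ki Kj.
  by exists k => //; case: (sF k Kk) => _ _ h _ _;
    apply: h; [exact: ik|exact: jk].
- move=> x y [i Ki Fx] [j Kj Fy]; have [k [Kk ik jk]] := dF i j Ki Kj.
  by exists k => //; case: (sF k Kk) => _ _ _ h _;
    apply: h; [exact: ik|exact: jk].
- by move=> x [i Ki Fx]; exists i => //; case: (sF i Ki) => _ _ _ _; apply.
Qed.

(** A form of [commute_sub] with a single interpolant: the inequality says that [a] and [c] are
    disjoint, and [e] with its complement replaces the pair of bounds. *)
Definition separates (D A C : set T) : Prop :=
  forall a c, A a -> C c -> a <= ~` c ->
    exists e, [/\ D e, a <= e & e <= ~` c].

Lemma separates_sym D A C : subalgebra D -> separates D A C -> separates D C A.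
Proof.
move=> [_ _ _ _ Dc] sep c a Cc Aa; rewrite lexC => ac.
have [e [De ae ec]] := sep a c Aa Cc ac.
by exists (~` e); split; [exact: Dc|rewrite lexC|rewrite leC].
Qed.

Lemma separates_sub D D' A A' C C' : (D `<=` D')%classic ->
  (A' `<=` A)%classic -> (C' `<=` C)%classic ->
  separates D A C -> separates D' A' C'.
Proof.
move=> DD AA CC sep a c /AA Aa /CC Cc /(sep a c Aa Cc)[e [De ae ec]].
by exists e; split=> //; exact: DD.
Qed.

Inductive joins X : T -> Prop :=
| joins_base x : X x -> joins X x
| joins_join x y : joins X x -> joins X y -> joins X (x `|` y).

Definition meets2 A S : set T :=
  [set x | exists a s, [/\ A a, S s & x = a `&` s]].

(** By distributivity finite joins of such meets are closed under meet, and De Morgan then gives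
    complements. Separation thus need only be checked on the meets. *)
Lemma gen_setU_joins A S : subalgebra A -> subalgebra S ->
  (gen (A `|` S)%classic `<=` joins (meets2 A S))%classic.
Proof.
move=> [A0 A1 Am _ Ac] [S0 S1 Sm _ Sc].
have mI x y : joins (meets2 A S) x -> joins (meets2 A S) y ->
    joins (meets2 A S) (x `&` y).
  elim=> {x} [_ [a [s [Aa Ss ->]]]|x1 x2 _ IH1 _ IH2] jy.
    elim: jy => {y} [_ [b [t [Ab St ->]]]|y1 y2 _ IH1 _ IH2].
      rewrite meetACA; apply: joins_base.
      by exists (a `&` b), (s `&` t); split; [exact: Am|exact: Sm|].
    by rewrite meetUr; exact: joins_join.
  by rewrite meetUl; apply: joins_join; [exact: IH1|exact: IH2].
apply: gen_min; last first.
  move=> x [Ax|Sx]; apply: joins_base; [exists x, \top|exists \top, x].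
    by rewrite meetx1.
  by rewrite meet1x.
split=> //.
- by apply: joins_base; exists \bot, \bot; rewrite meetxx.
- by apply: joins_base; exists \top, \top; rewrite meetxx.
- by move=> x y; exact: joins_join.
- move=> x; elim=> {x} [_ [a [s [Aa Ss ->]]]|x1 x2 _ IH1 _ IH2].
    rewrite complI; apply: joins_join; apply: joins_base.
      by exists (~` a), \top; rewrite meetx1; split=> //; exact: Ac.
    by exists \top, (~` s); rewrite meet1x; split=> //; exact: Sc.
  by rewrite complU; exact: mI.
Qed.

(** For fixed [c], interpolants of the parts of [a] are joined; symmetry of separation then treats
    the other side. *)
Lemma separates_joins D X Y : subalgebra D ->
  separates D X Y -> separates D (joins X) (joins Y).
Proof.
move=> sD sep; have [_ _ Dm Dj _] := sD.
have sep1 Z Z' : separates D Z Z' -> separates D (joins Z) Z'.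
  move=> sepZ a c ja Zc; elim: ja => {a} [a Za|a1 a2 _ IH1 _ IH2].
    exact: sepZ.
  rewrite leUx => /andP[/IH1[e1 [De1 a1e e1c]] /IH2[e2 [De2 a2e e2c]]].
  by exists (e1 `|` e2); split; [exact: Dj|exact: leU2|rewrite leUx e1c].
by apply/sep1/(separates_sym sD)/sep1/(separates_sym sD).
Qed.

Lemma le_split_compl (x y r : T) : x `&` r <= y -> x `&` ~` r <= y -> x <= y.
Proof.
move=> h1 h2; rewrite -[x]meetx1 -(joinxC r) meetUr leUx.
by rewrite h1 h2.
Qed.

Lemma meet_le_compl (x y z : T) : (x `&` y <= ~` z) = (x <= ~` (y `&` z)).
Proof. by rewrite -!disj_leC meetA. Qed.

(* An [r] in [R] separating [a `&` c] from [s] lets [a `&` s] be enlarged to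
   [a `&` ~` r], which lies in [A] and is still disjoint from [c]. *)
Lemma separates_extend_one R S B A C D :
  subalgebra A -> subalgebra S -> subalgebra D ->
  (A `<=` B)%classic -> (C `<=` B)%classic -> (R `<=` A)%classic ->
  subalgebra B -> separates R B S -> separates D A C ->
  separates D (gen (A `|` S)%classic) C.
Proof.
move=> sA sS sD AB CB RA sB sepBS sepAC.
apply: (@separates_sub D D (joins (meets2 A S)) _ (joins C) C) => //.
- exact: gen_setU_joins.
- by move=> c; exact: joins_base.
apply: separates_joins => // _ c [a [s [Aa Ss ->]]] Cc.
have [_ _ Bm _ _] := sB; have [_ _ Am _ Ac] := sA.
rewrite meet_le_compl meetC -meet_le_compl => acs.
have [|r [Rr acr rs]] := sepBS (a `&` c) s _ Ss acs.
  by apply: Bm; [exact: AB|exact: CB].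
have [||e [De ae ec]] := sepAC (a `&` ~` r) c _ Cc.
- by apply: Am => //; apply/Ac/RA.
- by rewrite meet_le_compl meetC -meet_le_compl complK.
exists e; split=> //; apply: le_trans ae; apply: leI2 => //.
by rewrite lexC.
Qed.

(* An [r] in [R] separating [a `&` c] from [s `&` t] splits the problem: [s] and
   [t] are disjoint on [r], while [a] and [c] are disjoint on [~` r]. *)
Lemma separates_extend_both R S B A C D :
  subalgebra A -> subalgebra C -> subalgebra S -> subalgebra D ->
  (A `<=` B)%classic -> (C `<=` B)%classic -> (R `<=` A)%classic ->
  (R `<=` S)%classic -> subalgebra B -> separates R B S -> separates D A C ->
  separates (gen (D `|` S)%classic) (gen (A `|` S)%classic)
    (gen (C `|` S)%classic).
Proof.
move=> sA sC sS sD AB CB RA RS sB sepBS sepAC.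
apply: (separates_sub (@subset_refl _ _) (gen_setU_joins sA sS)
  (gen_setU_joins sC sS)).
apply: separates_joins; first exact: gen_subalgebra.
move=> _ _ [a [s [Aa Ss ->]]] [c [t [Cc St ->]]].
have [_ _ Bm _ _] := sB; have [_ _ Am _ Ac] := sA; have [_ _ Sm _ _] := sS.
move=> asct.
have acst : a `&` c <= ~` (s `&` t).
  by move: asct; rewrite -!disj_leC meetACA.
have [||r [Rr acr rst]] := sepBS (a `&` c) (s `&` t) _ _ acst.
- by apply: Bm; [exact: AB|exact: CB].
- exact: Sm.
have [||e [De ae ec]] := sepAC (a `&` ~` r) c _ Cc.
- by apply: Am => //; apply/Ac/RA.
- by rewrite meet_le_compl meetC -meet_le_compl complK.
have [_ _ gm gj gc] := gen_subalgebra (D `|` S)%classic.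
(* The interpolant is [s] on [r] and [e] off [r]. *)
exists ((s `&` r) `|` (e `&` ~` r)); split.
- apply: gj; apply: gm.
  + by apply: gen_subset; right.
  + by apply: gen_subset; right; exact: RS.
  + by apply: gen_subset; left.
  + by apply: gc; apply: gen_subset; right; exact: RS.
- apply: (@le_split_compl _ _ r).
    by apply: lexUl; apply: leI2 => //; exact: leIr.
  apply: lexUr; rewrite lexI leIr andbT; apply: le_trans ae.
  by apply: leI2 => //; exact: leIl.
- rewrite leUx; apply/andP; split.
    apply: (@le_trans _ _ (~` t)); last by rewrite leC leIr.
    by rewrite meetC meet_le_compl.
  apply: (@le_trans _ _ e); first exact: leIl.
  by apply: le_trans ec _; rewrite leC leIl.
Qed.

End Subalgebras.

(** * Closed sets of stages of a push-out filtration *)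

Section Filtration.
Context {d : Order.disp_t} {T : ctbDistrLatticeType d}.
Context {I : Type} (lt : I -> I -> Prop) (R S : I -> set T).
Implicit Types (G K : set I).

Definition stage_gen G : set T := gen (\bigcup_(i in G) S i).

Definition below i : set I := [set j | lt j i].

Definition upto i : set I := [set j | lt j i \/ j = i].

Definition closed_stages G : Prop :=
  forall i, G i -> R i `<=` stage_gen (G `&` below i).

Definition downset K : Prop := forall i j, K j -> lt i j -> K i.

(* [stage_gen (below i)] plays the role of the paper's [B_i]. *)
Record pushout_filtration : Prop := PushoutFiltration {
  pf_trans : forall i j k, lt i j -> lt j k -> lt i k;
  pf_total : forall i j, i = j \/ lt i j \/ lt j i;
  pf_wf : well_founded lt;
  pf_subalgebra : forall i, subalgebra (S i);
  pf_countableR : forall i, countable (R i);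
  pf_countableS : forall i, countable (S i);
  pf_RS : forall i, R i `<=` S i;
  pf_R_below : forall i, R i `<=` stage_gen (below i);
  pf_separates : forall i, separates (R i) (stage_gen (below i)) (S i);
  pf_total_gen : forall x, stage_gen setT x
}.

Lemma stage_gen_subalgebra G : subalgebra (stage_gen G).
Proof. exact: gen_subalgebra. Qed.

Lemma stage_gen_mono G K : G `<=` K -> stage_gen G `<=` stage_gen K.
Proof. by move=> GK; apply: gen_mono => x [i /GK Ki Sx]; exists i. Qed.

Lemma stage_gen_S G i : G i -> S i `<=` stage_gen G.
Proof. by move=> Gi x Sx; apply: gen_subset; exists i. Qed.

Lemma countable_stage_gen G :
  (forall i, countable (S i)) -> countable G -> countable (stage_gen G).
Proof. by move=> cS cG; apply: countable_gen; exact: bigcup_countable. Qed.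

Lemma closed_stages_bigcup {J : Type} (D : set J) (F : J -> set I) :
  (forall j, D j -> closed_stages (F j)) ->
  closed_stages (\bigcup_(j in D) F j).
Proof.
move=> cF i [j Dj Fi] x /(cF j Dj i Fi).
by apply: stage_gen_mono => k [Fk ki]; split=> //; exists j.
Qed.

Lemma closed_stages_setU G K :
  closed_stages G -> closed_stages K -> closed_stages (G `|` K).
Proof.
move=> cG cK i [Gi|Ki] x.
  by move=> /(cG i Gi); apply: stage_gen_mono => k [Gk ki]; split=> //; left.
by move=> /(cK i Ki); apply: stage_gen_mono => k [Gk ki]; split=> //; right.
Qed.

Lemma stage_gen_upto_sub G i :
  stage_gen (G `&` upto i) `<=` gen (stage_gen (G `&` below i) `|` S i).
Proof.
apply: gen_subset_gen => x [j [Gj [ji|->]] Sx].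
  apply: gen_subset; left; exact: (@stage_gen_S _ j).
by apply: gen_subset; right.
Qed.

Lemma stage_gen_upto_sup G i : G i ->
  gen (stage_gen (G `&` below i) `|` S i) `<=` stage_gen (G `&` upto i).
Proof.
move=> Gi; apply: gen_subset_gen => x [].
  by apply: stage_gen_mono => j [Gj ji]; split=> //; left.
by apply: stage_gen_S; split=> //; right.
Qed.

Lemma stage_gen_upto_notin G i : ~ G i ->
  stage_gen (G `&` upto i) `<=` stage_gen (G `&` below i).
Proof.
move=> nGi; apply: stage_gen_mono => j [Gj [ji|ji]] //.
by rewrite ji in Gj.
Qed.

Context (pf : pushout_filtration).

(** Totality of the order makes the union directed, hence a subalgebra; nonemptiness of [K] supplies
    the constants. *)
Lemma stage_gen_directed G K : K !=set0 ->
  stage_gen (G `&` K) `<=` \bigcup_(j in K) stage_gen (G `&` upto j).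
Proof.
move=> K0; apply: gen_min.
  apply: subalgebra_bigcup => // [j _|i j Ki Kj]; first exact: gen_subalgebra.
  have mono k l : lt k l ->
      stage_gen (G `&` upto k) `<=` stage_gen (G `&` upto l).
    move=> kl; apply: stage_gen_mono => m [Gm mk]; split=> //; left.
    by case: mk => [mk|->//]; exact: (pf_trans pf) kl.
  have [<-|[ij|ji]] := pf_total pf i j.
  - by exists i; split.
  - by exists j; split=> //; exact: mono.
  - by exists i; split=> //; exact: mono.
move=> x [i [Gi Ki] Sx]; exists i => //; apply: (@stage_gen_S _ i) => //.
by split=> //; right.
Qed.

(** Both elements already occur at a common stage of [K], and [K] being a downset keeps the
    interpolant inside. *)
Lemma separates_directed G G' K : downset K ->
  (forall i, K i -> separates (stage_gen ((G `&` G') `&` upto i))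
     (stage_gen (G `&` upto i)) (stage_gen (G' `&` upto i))) ->
  separates (stage_gen ((G `&` G') `&` K)) (stage_gen (G `&` K))
    (stage_gen (G' `&` K)).
Proof.
move=> dK sepK; have [K0|nK] := pselect (K !=set0); last first.
  move=> a c Ga _ ac; exists a; split=> //.
  by move: Ga; apply: stage_gen_mono => i [_ Ki]; case: nK; exists i.
have mono H i j : lt i j \/ i = j ->
    stage_gen (H `&` upto i) `<=` stage_gen (H `&` upto j).
  move=> ij; apply: stage_gen_mono => k [Hk ki]; split=> //.
  case: ij => [ij|<-//]; left.
  by case: ki => [ki|->//]; exact: (pf_trans pf) ij.
move=> a c /(stage_gen_directed K0)[i Ki ai] /(stage_gen_directed K0)[j Kj cj].
have [k [Kk ak ck]] : exists k, [/\ K k, stage_gen (G `&` upto k) a &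
    stage_gen (G' `&` upto k) c].
  have [ij|[ij|ji]] := pf_total pf i j.
  - by exists j; split=> //; move: ai; apply: mono; right.
  - by exists j; split=> //; move: ai; apply: mono; left.
  - by exists i; split=> //; move: cj; apply: mono; left.
move=> /(sepK k Kk a c ak ck)[e [De ae ec]]; exists e; split=> //.
move: De; apply: stage_gen_mono => l [Hl lk]; split=> //.
by case: lk => [lk|->//]; exact: dK lk.
Qed.

Lemma closed_stages_separates G G' : closed_stages G -> closed_stages G' ->
  separates (stage_gen (G `&` G')) (stage_gen G) (stage_gen G').
Proof.
move=> cG cG'.
suff sepi i : separates (stage_gen ((G `&` G') `&` upto i))
    (stage_gen (G `&` upto i)) (stage_gen (G' `&` upto i)).
  by have := @separates_directed G G' setT; rewrite !setIT; apply.
elim: (pf_wf pf i) => {}i _ IH.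
(* Since [below i] is a downset, this treats successor and limit positions of [i] alike. *)
have {IH} sepb : separates (stage_gen ((G `&` G') `&` below i))
    (stage_gen (G `&` below i)) (stage_gen (G' `&` below i)).
  apply: separates_directed => // k j ji kj; exact: (pf_trans pf) ji.
have subB H : stage_gen (H `&` below i) `<=` stage_gen (below i).
  by apply: stage_gen_mono => j [].
have sg := stage_gen_subalgebra.
have sS := pf_subalgebra pf i.
have sepi := @pf_separates pf i.
have ext H : stage_gen (H `&` below i) `<=` stage_gen (H `&` upto i).
  by apply: stage_gen_mono => j [Hj ji]; split=> //; left.
(* If [i] belongs to a closed set, closedness puts [R i] in its trace below [i], as the extension
   lemmas require; otherwise the trace is unchanged. *)
have [Gi|nGi] := pselect (G i); have [Gi'|nGi'] := pselect (G' i).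
- apply: (separates_sub (@stage_gen_upto_sup _ _ _) (@stage_gen_upto_sub _ _)
    (@stage_gen_upto_sub _ _)) => //.
  apply: (@separates_extend_both _ _ (R i) (S i) (stage_gen (below i))) => //.
  + exact: cG.
  + exact: pf_RS.
- apply: (separates_sub (ext _) (@stage_gen_upto_sub _ _)
    (stage_gen_upto_notin nGi')) => //.
  apply: (@separates_extend_one _ _ (R i) (S i) (stage_gen (below i))) => //.
  exact: cG.
- apply: (separates_sub (ext _) (stage_gen_upto_notin nGi)
    (@stage_gen_upto_sub _ _)) => //.
  apply: separates_sym => //.
  apply: (@separates_extend_one _ _ (R i) (S i) (stage_gen (below i))) => //.
    exact: cG'.
  exact: separates_sym.
- exact: separates_sub (ext _) (stage_gen_upto_notin nGi)
    (stage_gen_upto_notin nGi') _.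
Qed.

(** The algebra of [K] is the directed union of those of its countable closed subsets; choose one
    for each element of [X] and unite them. *)
Lemma countable_support K :
  (forall i, K i ->
     exists G, [/\ countable G, closed_stages G, G `<=` K & G i]) ->
  forall X : set T, countable X -> X `<=` stage_gen K ->
  exists G, [/\ countable G, closed_stages G, G `<=` K & X `<=` stage_gen G].
Proof.
move=> covK X cX XK.
pose Q G := [/\ countable G, closed_stages G & G `<=` K].
have KQ : stage_gen K `<=` \bigcup_(G in Q) stage_gen G.
  apply: gen_min.
    apply: subalgebra_bigcup => [|G _|G G' [cG clG GK] [cG' clG' GK']].
    - exists set0; split=> //; by [exact: countable0|move=> ?].
    - exact: gen_subalgebra.
    - exists (G `|` G'); split.
      + split; [exact: countable_setU|exact: closed_stages_setU|].
        by rewrite subUset.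
      + by apply: stage_gen_mono; exact: subsetUl.
      + by apply: stage_gen_mono; exact: subsetUr.
  move=> x [i Ki Sx]; have [G [cG clG GK Gi]] := covK i Ki.
  by exists G => //; exact: stage_gen_S Sx.
have supp_ex x : exists G, X x -> Q G /\ stage_gen G x.
  have [Xx|nXx] := pselect (X x); last by exists set0.
  by have [G QG Gx] := KQ x (XK x Xx); exists G.
have [F FP] := choice supp_ex.
exists (\bigcup_(x in X) F x); split.
- by apply: bigcup_countable => // x Xx; have [[]] := FP x Xx.
- by apply: closed_stages_bigcup => x Xx; have [[]] := FP x Xx.
- by move=> i [x Xx Fi]; have [[_ _ FK] _] := FP x Xx; exact: FK.
- move=> x Xx; have [_] := FP x Xx; apply: stage_gen_mono => i Fi.
  by exists x.
Qed.

(** By induction all earlier stages have such sets, so the countable [R i] is supported by a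
    countable closed set below [i]; adjoining [i] keeps it closed. *)
Lemma countable_closed_stage i :
  exists G, [/\ countable G, closed_stages G, G `<=` upto i & G i].
Proof.
elim: (pf_wf pf i) => {}i _ IH.
have [j ji|||G [cG clG Gi RG]] := @countable_support (below i) _ (R i).
- have [G [cG clG Gj Gjj]] := IH j ji; exists G; split=> // k /Gj[kj|->//].
  exact: (pf_trans pf) ji.
- exact: pf_countableR.
- exact: pf_R_below.
exists (G `|` [set i]); split; [exact: countable_setU| | |by right].
  move=> j [Gj|->] x; last first.
    by move=> /RG; apply: stage_gen_mono => k Gk; split; [left|exact: Gi].
  by move=> /(clG j Gj); apply: stage_gen_mono => k [Gk kj]; split=> //; left.
by move=> j [/Gi|->]; [left|right].
Qed.

Lemma countable_closed_support (X : set T) : countable X ->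
  exists G, [/\ countable G, closed_stages G & X `<=` stage_gen G].
Proof.
move=> cX; have [i _|//|x _|G [? ? _ ?]] := @countable_support setT _ X.
- by have [G [? ? _ ?]] := countable_closed_stage i; exists G.
- exact: pf_total_gen.
- by exists G.
Qed.

Lemma countable_closed_superset G : countable G ->
  exists G', [/\ countable G', closed_stages G' & G `<=` G'].
Proof.
move=> cG; have [F FP] := choice countable_closed_stage.
exists (\bigcup_(i in G) F i); split.
- by apply: bigcup_countable => // i _; have [] := FP i.
- by apply: closed_stages_bigcup => i _; have [] := FP i.
- by move=> i Gi; exists i => //; have [] := FP i.
Qed.

Local Open Scope order_scope.

(** Induction on [s], with [z] arbitrary because the tail must be bounded by the complement of an
    interpolant rather than by [z]. *)
Lemma separates_many (n : nat) (G : 'I_n -> set I) (G0 : set I) (s : seq 'I_n)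
    (a : 'I_n -> T) (z : T) :
  (forall i, closed_stages (G i)) -> (forall i, G0 `<=` G i)%classic ->
  (forall i j, i != j -> (G i `&` G j `<=` G0)%classic) ->
  uniq s -> (forall i, stage_gen (G i) (a i)) -> stage_gen G0 z ->
  \meet_(i <- s) a i <= z ->
  exists r : 'I_n -> T, [/\ (forall i, stage_gen G0 (r i)),
    (forall i, a i <= r i) & \meet_(i <- s) r i <= z].
Proof.
move=> clG G0G GG; elim: s z => [|i s IH] z.
  rewrite big_nil => _ aG z0 z1; exists (fun=> \top); rewrite big_nil.
  by split=> // i; case: (stage_gen_subalgebra G0).
move=> /= /andP[nis us] aG z0; rewrite big_cons => az.
pose G' := (\bigcup_(j in [set j | j \in s]) G j)%classic.
have clG' : closed_stages G' by apply: closed_stages_bigcup.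
have G'a : stage_gen G' (\meet_(j <- s) a j).
  have [_ g1 gm _ _] := stage_gen_subalgebra G'.
  rewrite big_seq; apply: (big_ind (stage_gen G')) => // j js.
  by apply: stage_gen_mono (aG j) => k Gk; exists j.
have [_ _ gm _ gc] := stage_gen_subalgebra (G i).
have z0i : stage_gen (G i) z by apply: stage_gen_mono z0.
(* The part of [a i] off [z] is disjoint from the meet of the others; their interpolant [e] lies
   over [G0], where [G i] meets the other sets. *)
have [|e [De ae ec]] := closed_stages_separates (clG i) clG'
    (gm _ _ (aG i) (gc _ z0i)) G'a.
  by rewrite -disj_leC meetAC disj_leC complK.
have e0 : stage_gen G0 e.
  move: De; apply: stage_gen_mono => k [Gik [j /= js Gjk]].
  by apply: (GG i j) => //; apply: contraNneq nis => ->.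
have [_ _ _ hj hc] := stage_gen_subalgebra G0.
have [|r [rG0 ar rz]] := IH (~` e) us aG (hc _ e0); first by rewrite lexC.
exists (fun j => if j == i then z `|` e else r j); split.
- by move=> j; case: ifP => // _; exact: hj.
- move=> j; case: ifP => // /eqP ->; apply: (@le_split_compl _ _ _ _ z).
    by apply: lexUl; exact: leIr.
  exact: lexUr.
- rewrite big_cons eqxx (@eq_big_seq _ _ _ _ s _ r); last first.
    by move=> j js; case: eqP => // ji; rewrite -ji js in nis.
  rewrite meetUl leUx leIl /=.
  apply: (@le_trans _ _ (e `&` ~` e)); first by rewrite leI2.
  by rewrite meetxC le0x.
Qed.

End Filtration.

(** * From a tightly sigma-filtered chain to a push-out filtration *)

Lemma tightly_sigma_filtered_pushout (d : Order.disp_t)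
    (T : ctbDistrLatticeType d) :
  @tightly_sigma_filtered d T ->
  exists (I : Type) (lt : I -> I -> Prop) (R S : I -> set T),
    pushout_filtration lt R S.
Proof.
move=> [I [lt [B [irr [tr [tot [min [sB [mB [B0 [Btot [Blim Bsucc]]]]]]]]]]]].
have wf := well_founded_of_minima min.
pose succ i i' := lt i i' /\ forall k, ~ (lt i k /\ lt k i').
have succ_uniq i i' i'' : succ i i' -> succ i i'' -> i' = i''.
  move=> [ii' h'] [ii'' h'']; have [//|[l|l]] := tot i' i''.
    by case: (h'' i').
  by case: (h' i'').
have succ_ex i j : lt i j -> exists2 i', succ i i' & lt i' j \/ i' = j.
  move=> ij; have [|i' ii' imin] := min [set k | lt i k]; first by exists j.
  exists i'; first by split=> // k [ik ki']; exact: (imin k).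
  have [->|[|ji']] := tot i' j; [by right|by left|by case: (imin j)].
have stage_ex i : exists RS : set T * set T,
    [/\ countable RS.1, countable RS.2, subalgebra RS.2, RS.1 `<=` B i &
        RS.1 `<=` RS.2] /\
    separates RS.1 (B i) RS.2 /\
    (forall i', succ i i' -> gen (B i `|` RS.2) = B i').
  have [[i' si]|ni] := pselect (exists i', succ i i'); last first.
    (* A last stage has no push-out square; the two-element subalgebra serves as both members. *)
    exists (gen set0, gen set0) => /=.
    have c0 : countable (gen set0 : set T) by exact: countable_gen.
    split; [split=> //|split].
    - exact: gen_subalgebra.
    - exact: gen_min.
    - move=> a c Ba; rewrite gen_set0 => -[->|->] ac.
        by exists (Order.top); rewrite lex1 compl0 lexx; split=> //; right.
      by exists (Order.bottom); rewrite le0x -compl1; split=> //; left.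
    - by move=> i' si; case: ni; exists i'.
  have [R [S [cR cS sR sS [[RB BB RS SB] [gB BSR com]]]]] :=
    Bsucc i i' si.1 si.2.
  exists (R, S) => /=; split=> //; split.
    move=> a s Ba Ss; rewrite -disj_leC => /eqP /(com a s Ba Ss)
      [b1 [b2 [Rb1 Rb2 ab sb b12]]].
    exists b1; split=> //; first by rewrite -BSR.
    rewrite -disj_leC; apply/eqP/le_anti; rewrite le0x andbT -b12.
    exact: leI2.
  by move=> i'' /(succ_uniq _ _ _ si) <-.
have [RS RSP] := choice stage_ex.
pose R i := (RS i).1; pose S i := (RS i).2.
(* [S j] lies in the algebra at the successor of [j], which is at most [i]. *)
have EB i : stage_gen S (below lt i) `<=` B i.
  apply: gen_min => // x [j /= ji Sx]; have [j' sj j'i] := succ_ex j i ji.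
  have [_ [_ /(_ j' sj) Bj']] := RSP j.
  have : B j' x by rewrite -Bj'; apply: gen_subset; right.
  by case: j'i => [/mB|->//]; apply.
(* Induction with a least, a successor and a limit case. *)
have BE i : B i `<=` stage_gen S (below lt i).
  elim: (wf i) => {}i _ IH.
  have [[j0 j0i]|ni] := pselect (exists j, lt j i); last first.
    rewrite B0; last by move=> j ji; apply: ni; exists j.
    by rewrite -gen_set0; apply: gen_mono.
  have [[k ski]|nk] := pselect (exists k, succ k i).
    have [_ [_ /(_ i ski) <-]] := RSP k; have [ki _] := ski.
    apply: gen_subset_gen => x [/(IH k ki)|Sx].
      by apply: stage_gen_mono => j jk; exact: tr ki.
    by apply: gen_subset; exists k.
  rewrite Blim; last 2 first.
  - by exists j0.
  - move=> j ji; apply: contrapT => H; apply: nk; exists j; split=> // k jk.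
    by apply: H; exists k.
  move=> x [j ji Bx]; have := IH j ji x Bx; apply: stage_gen_mono => k kj.
  exact: tr ji.
have BEE i : B i = stage_gen S (below lt i) by apply/seteqP.
exists I, lt, R, S; split=> //.
- by move=> i; have [[]] := RSP i.
- by move=> i; have [[]] := RSP i.
- by move=> i; have [[]] := RSP i.
- by move=> i; have [[]] := RSP i.
- by move=> i; rewrite -BEE; have [[]] := RSP i.
- by move=> i; rewrite -BEE; have [_ []] := RSP i.
- move=> x; have [i /BE] := Btot x; exact: stage_gen_mono.
Qed.

(** * Boolean polynomials *)

Section Polynomials.
Context {d : Order.disp_t} {T : ctbDistrLatticeType d} {n : nat}.
Implicit Types (v : 'I_n -> T) (f : {ffun 'I_n -> bool}) (P : bpoly n).

Local Open Scope order_scope.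

Definition literal (b : bool) (x : T) : T := if b then x else ~` x.

Definition minterm f v : T := \meet_(i < n) literal (f i) (v i).

(** [beval P f] is evaluated in the two-element algebra [bool]; below the minterm of [f] every
    subterm agrees with its truth value at [f]. *)
Lemma minterm_le_literal P f v :
  minterm f v <= literal (beval P f) (beval P v).
Proof.
elim: P => [i|||p IHp q IHq|p IHp q IHq|p IHp] /=.
- exact: meets_inf.
- by rewrite /literal compl0 lex1.
- exact: lex1.
- move: IHp IHq; rewrite /literal.
  case: (beval p f); case: (beval q f) => /= hp hq; rewrite ?lexI ?hp ?hq //=;
    rewrite complI; apply/lexU2; by rewrite ?hp ?hq ?orbT.
- move: IHp IHq; rewrite /literal.
  case: (beval p f); case: (beval q f) => /= hp hq;
    rewrite ?complU ?lexI ?hp ?hq //; apply/lexU2; by rewrite ?hp ?hq ?orbT.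
- by move: IHp; rewrite /literal; case: (beval p f) => //=; rewrite complK.
Qed.

Lemma minterm_partition v (x : T) :
  (forall f, x `&` minterm f v = \bot) -> x = \bot.
Proof.
rewrite /minterm; elim: (index_enum _) (index_enum_uniq 'I_n) x =>
  [_ x|i s IH /= /andP[nis us] x x0].
  by move=> /(_ [ffun=> true]); rewrite big_nil meetx1.
have xlit b : x `&` literal b (v i) = \bot.
  (* Overriding [f] at [i] does not affect the other factors, as [i] is not in [s]. *)
  apply: IH => // f; have := x0 [ffun j => if j == i then b else f j].
  rewrite big_cons ffunE eqxx meetA => <-; congr (_ `&` _).
  apply: eq_big_seq => j js; rewrite ffunE; case: eqP => // ji.
  by rewrite -ji js in nis.
by apply/le_anti; rewrite le0x andbT; apply: (@le_split_compl _ _ _ _ (v i));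
  rewrite ?(xlit true) ?(xlit false).
Qed.

(** Disjunctive normal form: the value of [P] is the join of the minterms at which [P] is true. *)
Lemma beval_eq0 P v :
  beval P v = \bot <-> (forall f, beval P f -> minterm f v = \bot).
Proof.
split=> [P0 f Pf|H].
  have := minterm_le_literal P f v; rewrite Pf /literal P0.
  by rewrite lex0 => /eqP.
apply: (@minterm_partition v) => f.
case Pf: (beval P f); first by rewrite H // meetx0.
have := minterm_le_literal P f v; rewrite Pf /literal => h.
by apply/eqP; rewrite meetC disj_leC.
Qed.

(* [rp i] is the meet, and [rm i] the complement of the meet, of the upper
   bounds found for the literals [a i] and [~` a i] in the minterms of [P]. *)
Lemma beval_bounds (R : set T) P (a : 'I_n -> T) : subalgebra R ->
  (forall f, minterm f a = \bot -> exists r : 'I_n -> T,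
    [/\ (forall i, R (r i)), (forall i, literal (f i) (a i) <= r i) &
        \meet_(i < n) r i = \bot]) ->
  beval P a = \bot ->
  exists rm rp : 'I_n -> T,
    [/\ (forall i, R (rm i)), (forall i, R (rp i)),
        (forall i, rm i <= a i), (forall i, a i <= rp i) &
        (forall eps : 'I_n -> bool,
           beval P (fun i => if eps i then rp i else rm i) = \bot)].
Proof.
move=> [R0 R1 Rm Rj Rc] HR /beval_eq0 Pa.
have r_ex f : exists r : 'I_n -> T, beval P f ->
    [/\ (forall i, R (r i)), (forall i, literal (f i) (a i) <= r i) &
        \meet_(i < n) r i = \bot].
  case Pf: (beval P f); last by exists (fun=> \top).
  by have [r rP] := HR f (Pa f Pf); exists r.
have [r rP] := choice r_ex.
pose rp i := \meet_(f : {ffun 'I_n -> bool} | beval P f && f i) r f i.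
pose rm i := \join_(f : {ffun 'I_n -> bool} | beval P f && ~~ f i) ~` r f i.
have arp i : a i <= rp i.
  apply/meetsP => f /andP[Pf fi]; have [_ /(_ i)] := rP f Pf.
  by rewrite fi.
have rma i : rm i <= a i.
  apply/joinsP => f /andP[Pf /negbTE fi]; have [_ /(_ i)] := rP f Pf.
  by rewrite fi /literal leCx.
exists rm, rp; split=> //.
- move=> i; apply: (big_ind R) => // f /andP[Pf _]; apply: Rc.
  by have [] := rP f Pf.
- move=> i; apply: (big_ind R) => // f /andP[Pf _].
  by have [] := rP f Pf.
move=> eps; apply/beval_eq0 => f Pf; have [_ _ r0] := rP f Pf.
apply/le_anti; rewrite le0x andbT -r0; apply/meetsP => i _.
apply: (@meets_max _ _ _ i) => //; rewrite /literal.
(* Either sign yields a value between [rm i] and [rp i], so its literal stays below [r f i]. *)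
case fi: (f i).
  apply: (@le_trans _ _ (rp i)).
    by case: (eps i) => //; exact: le_trans (arp i).
  by apply: meets_inf; rewrite Pf fi.
rewrite leCx; apply: (@le_trans _ _ (rm i)).
  by apply: joins_sup; rewrite Pf fi.
by case: (eps i) => //; exact: le_trans (arp i).
Qed.

End Polynomials.

(** * Choice of the large subfamily and of the countable subalgebra *)

Theorem theorem4p2 (d : Order.disp_t) (T : ctbDistrLatticeType d)
  (H : set (set T)) :
  @tightly_sigma_filtered d T ->
  (forall X, H X -> countable X) ->
  card_eq_aleph2 H ->
  exists (H' : set (set T)) (R : set T),
    [/\ H' `<=` H, card_eq_aleph2 H', countable R, subalgebra R &
      forall (n : nat) (P : bpoly n) (Hs : 'I_n -> set T) (a : 'I_n -> T),
        injective Hs ->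
        (forall i, H' (Hs i)) ->
        (forall i, Hs i (a i)) ->
        beval P a = Order.bottom ->
        exists rm rp : 'I_n -> T,
          [/\ (forall i, R (rm i)), (forall i, R (rp i)),
              (forall i, Order.le (rm i) (a i)),
              (forall i, Order.le (a i) (rp i)) &
              (forall eps : 'I_n -> bool,
                 beval P (fun i => if eps i then rp i else rm i)
                   = Order.bottom)]].
Proof.
move=> /tightly_sigma_filtered_pushout[I [lt [Rs [S pf]]]] cH aleph2H.
have supp_ex X : exists G, H X ->
    [/\ countable G, closed_stages lt Rs S G & X `<=` stage_gen S G].
  have [HX|nHX] := pselect (H X); last by exists set0.
  by have [G GP] := countable_closed_support pf (cH X HX); exists G.
have [G GP] := choice supp_ex.
have [|Delta [H' [cD H'H aleph2H' disj]]] :=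
    large_disjoint_modulo_countable (G := G) aleph2H.
  by move=> X /GP[].
have [G0 [cG0 clG0 DG0]] := countable_closed_superset pf cD.
exists H', (stage_gen S G0); split=> //.
- by apply: countable_stage_gen => //; exact: pf_countableS pf.
- exact: stage_gen_subalgebra.
move=> n P Hs a injHs H'Hs Hsa.
apply: beval_bounds => [|f fa]; first exact: stage_gen_subalgebra.
(* Adjoining [G0] keeps the sets closed and makes them pairwise meet inside [G0], which contains
   [Delta]. *)
pose Gi i := G (Hs i) `|` G0.
have HHs i : H (Hs i) by exact: H'H.
have [|||||||r [rG0 ar r0]] := @separates_many _ _ _ _ _ _ pf n Gi G0
    (index_enum _) (fun i => literal (f i) (a i)) Order.bottom.
- by move=> i; apply: closed_stages_setU => //; have [] := GP _ (HHs i).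
- by move=> i; exact: subsetUr.
- move=> i j ij; rewrite -setUIl subUset; split=> //.
  apply: subset_trans DG0; apply: disj => // /injHs /eqP.
  by rewrite (negbTE ij).
- exact: index_enum_uniq.
- move=> i; have [_ _ _ _ gc] := stage_gen_subalgebra S (Gi i).
  have Ga : stage_gen S (Gi i) (a i).
    have [_ _ HG] := GP _ (HHs i).
    by apply: stage_gen_mono (HG _ (Hsa i)); exact: subsetUl.
  by rewrite /literal; case: (f i) => //; exact: gc.
- by case: (stage_gen_subalgebra S G0).
- by rewrite -/(minterm f a) fa.
exists r; split=> //; apply/eqP; by rewrite -lex0.
Qed.
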